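(* Let $r\geq 1$, let $l_1,\dots,l_r$ be positive integers, and let $m_1,\dots,m_r$ be integers with $1\leq m_1<m_2<\cdots<m_r$. If $\Gamma=l_1K_{m_1}\cup l_2K_{m_2}\cup\cdots\cup l_rK_{m_r}$, then $E_{\mathrm{CN}}(K_{|V(\Gamma)|})>E_{\mathrm{CN}}(\Gamma)$.
   Context: $K_n$ is the complete graph on $n$ vertices, $lK_m$ is the disjoint union of $l$ copies of $K_m$, and $\cup$ denotes disjoint union of graphs. For a finite simple graph $\Gamma$ with vertices $v_1,\dots,v_n$, the common neighborhood matrix $\mathrm{CN}(\Gamma)$ is the $n\times n$ matrix whose $(i,j)$ entry is $|C(v_i,v_j)|$ if $i\neq j$ and $0$ if $i=j$, where $C(v_i,v_j)$ is the set of common neighbours of $v_i$ and $v_j$. The CN-energy $E_{\mathrm{CN}}(\Gamma)$ is the sum of the absolute values of the eigenvalues of $\mathrm{CN}(\Gamma)$, counted with multiplicity.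
   Formalization: The formal theorem additionally assumes that Γ has more than one component (l_1+…+l_r > 1) and more than two vertices; otherwise Γ is itself complete or both energies are 0, and the strict inequality fails. *)

(* Defs.v *)
From HB Require Import structures.
From mathcomp Require Import all_boot all_order all_algebra.

Set Implicit Arguments.
Unset Strict Implicit.
Unset Printing Implicit Defensive.

Import GRing.Theory Num.Theory.

Local Open Scope ring_scope.

Record sgraph : Type := SGraph {
  vertex :> finType;
  adj : rel vertex;
  adj_sym : symmetric adj;
  adj_irr : irreflexive adj
}.

Section Complete.

Variable n : nat.

Definition complete_adj : rel 'I_n := fun x y => x != y.

Lemma complete_adj_sym : symmetric complete_adj.
Proof. by move=> x y; rewrite /complete_adj eq_sym. Qed.

Lemma complete_adj_irr : irreflexive complete_adj.
Proof. by move=> x; rewrite /complete_adj eqxx. Qed.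

Definition complete : sgraph := SGraph complete_adj_sym complete_adj_irr.

End Complete.

Section DisjointUnion.

Variables (I : finType) (G : I -> sgraph).

Local Notation dvertex := {i : I & vertex (G i)}.

(* [tagged_as u v] is [v] transported to the component of [u]; it is only
   meaningful when both tags agree, which the first conjunct ensures. *)
Definition dunion_adj : rel dvertex := fun u v =>
  (tag u == tag v) && adj (tagged u) (tagged_as u v).

Lemma dunion_adj_sym : symmetric dunion_adj.
Proof.
move=> [i x] [j y]; rewrite /dunion_adj /=.
have [eq_ij|//] := eqVneq i j.
by case: j / eq_ij y => y; rewrite !tagged_asE adj_sym.
Qed.

Lemma dunion_adj_irr : irreflexive dunion_adj.
Proof. by move=> [i x]; rewrite /dunion_adj /= eqxx tagged_asE adj_irr. Qed.

Definition dunion : sgraph := SGraph dunion_adj_sym dunion_adj_irr.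

End DisjointUnion.

Definition copies (l : nat) (G : sgraph) : sgraph := dunion (fun _ : 'I_l => G).

Definition union_of_completes (r : nat) (l m : 'I_r -> nat) : sgraph :=
  dunion (fun i : 'I_r => copies (l i) (complete (m i))).

Definition common_nbrs (G : sgraph) (u v : G) : {set G} :=
  [set w | adj u w & adj v w].

(* The vertices are numbered by the canonical enumeration of the finType. *)
Definition CN_mx (R : pzRingType) (G : sgraph) : 'M[R]_#|G| :=
  \matrix_(i, j)
    (if i == j then 0 else #|common_nbrs (enum_val i) (enum_val j)|%:R).

(* Eigenvalues with algebraic multiplicity: the roots of the characteristic
   polynomial over an algebraically closed field. *)
Definition spectrum (C : closedFieldType) (n : nat) (A : 'M[C]_n) : seq C :=
  sval (closed_field_poly_normal (char_poly A)).

Lemma spectrumP (C : closedFieldType) (n : nat) (A : 'M[C]_n) :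
  char_poly A = \prod_(a <- spectrum A) ('X - a%:P).
Proof.
rewrite /spectrum; case: closed_field_poly_normal => s /= {1}->.
by rewrite (monicP (char_poly_monic A)) scale1r.
Qed.

Definition CN_energy (C : numClosedFieldType) (G : sgraph) : C :=
  \sum_(a <- spectrum (CN_mx C G)) `|a|.

(* Main.v *)
(** Let [d v] be the clique of the vertex [v], [s a] the order of the clique
    [a], [w a = s a - 2], and [P] the incidence matrix of vertices against
    cliques.  Then [CN = P W P^T - diag (w (d v))].  Computing
    [det [[X + diag (w (d v)), P W], [P^T, 1]]] by eliminating either diagonal
    block gives
    [char_poly CN * prod_a (X + w a)
       = prod_v (X + w (d v)) * prod_a (X + w a - s a * w a)],
    hence the energy is [2 * sum_a (s a - 1) (s a - 2)].  With at least two
    cliques on [N] vertices, each has order at most [N - 1], so that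
    [sum_a (s a - 1) (s a - 2) <= (N - 2) (N - 3) < (N - 1) (N - 2)]. *)
Require Import Defs.
From mathcomp Require Import all_boot all_order all_algebra.
From mathcomp Require Import zify.

Set Implicit Arguments.
Unset Strict Implicit.
Unset Printing Implicit Defensive.

Import Order.TTheory GRing.Theory Num.Theory.

Local Open Scope ring_scope.

(** The factors ['X + (w a)%:P] stay on the left because nothing is divided. An empty class adds the
    same factor to both sides. *)
Lemma char_poly_blocks (R : comNzRingType) (n k : nat) (d : 'I_n -> 'I_k)
    (w : 'I_k -> R) (A : 'M[R]_n) :
  (forall i j, A i j = if i == j then 0
                       else if d i == d j then w (d i) else 0) ->
  char_poly A * \prod_a ('X + (w a)%:P)
    = \prod_i ('X + (w (d i))%:P)
      * \prod_a ('X + (w a)%:P - (w a *+ #|[set i | d i == a]|)%:P).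
Proof.
move=> AE.
pose P : 'M[{poly R}]_(n, k) := \matrix_(i, a) (d i == a)%:R.
pose W : 'M[{poly R}]_k := diag_mx (\row_a (w a)%:P).
pose L : 'M[{poly R}]_k := diag_mx (\row_a ('X + (w a)%:P)).
pose V : 'M[{poly R}]_n := diag_mx (\row_i ('X + (w (d i))%:P)).
pose S : 'M[{poly R}]_k :=
  diag_mx (\row_a ('X + (w a)%:P - (w a *+ #|[set i | d i == a]|)%:P)).
have PWE i a : (P *m W) i a = (d i == a)%:R * (w a)%:P.
  by rewrite mul_mx_diag !mxE.
have PWPE i j : (P *m W *m P^T) i j = (d i == d j)%:R * (w (d i))%:P.
  rewrite mxE (bigD1 (d i)) //= big1 ?addr0 => [|a ne_a].
    by rewrite PWE !mxE eqxx mul1r mulrC eq_sym.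
  by rewrite PWE eq_sym (negbTE ne_a) !mul0r.
have charE : char_poly_mx A = V - P *m W *m P^T.
  apply/matrixP=> i j.
  rewrite [RHS]mxE [X in _ = _ + X]mxE PWPE !mxE AE.
  have [->|ne_ij] := eqVneq i j.
    by rewrite eqxx !mulr1n mul1r addrK subr0.
  by rewrite !mulr0n; case: ifP => _; rewrite ?mul1r ?mul0r ?polyC0.
(* [V] is constant on each class, so it passes through the incidence matrix and becomes [L]. *)
have VP : V *m (P *m W) = P *m W *m L.
  apply/matrixP=> i a; rewrite [V *m _]mul_diag_mx [_ *m L]mul_mx_diag.
  rewrite [LHS]mxE [RHS]mxE !PWE !mxE.
  by have [->|_] := eqVneq (d i) a; rewrite ?mul0r ?mulr0 // mulrC.
(* [P^T *m P] is diagonal, with the class sizes as entries. *)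
have SE : L - P^T *m (P *m W) = S.
  apply/matrixP=> a b.
  have PPW : (P^T *m (P *m W)) a b
      = (w b *+ #|[set i | d i == b]|)%:P *+ (a == b).
    rewrite mxE (eq_bigr (fun i => ((d i == a) && (d i == b))%:R * (w b)%:P)).
      rewrite -mulr_suml -natr_sum mulr_natl polyCMn.
      have [->|ne_ab] := eqVneq a b.
        rewrite mulr1n -sum1_card [in RHS]big_mkcond /=; congr (_ *+ _).
        by apply: eq_bigr => i _; rewrite andbb inE; case: eqP.
      rewrite big1 ?mulr0n // => i _; have [->|//] := eqVneq (d i) a.
      by rewrite (negbTE ne_ab).
    by move=> i _; rewrite PWE !mxE mulrA -natrM mulnb.
  rewrite [LHS]mxE [X in _ + X = _]mxE PPW !mxE.
  by have [->|_] := eqVneq a b; rewrite ?mulr1n // !mulr0n subr0.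
pose M := block_mx V (P *m W) P^T 1%:M.
have detM : \det M = char_poly A.
  have : M *m block_mx 1%:M 0 (- P^T) 1%:M
       = block_mx (char_poly_mx A) (P *m W) 0 1%:M.
    rewrite mulmx_block !mulmx1 !mulmx0 !mul1mx !add0r subrr.
    by rewrite mulmxN charE.
  by move/(congr1 determinant);
     rewrite det_mulmx det_lblock det_ublock !det1 !mulr1.
(* Scaling the last block column by [L] avoids inverting [V]; by [VP] the upper right block
   cancels. *)
have : M *m block_mx 1%:M (- (P *m W)) 0 L = block_mx V 0 P^T S.
  rewrite mulmx_block !mulmx1 !mulmx0 !mul1mx !addr0 !mulmxN VP addNr.
  by rewrite addrC SE.
move/(congr1 determinant).
rewrite det_mulmx det_ublock det_lblock det1 mul1r detM !det_diag => E.
have rowE (p : nat) (f : 'I_p -> {poly R}) :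
    \prod_i (\row_a f a) 0 i = \prod_i f i.
  by apply: eq_bigr => i _; rewrite mxE.
by rewrite !rowE in E.
Qed.

(* The truncated subtractions are harmless: the summand is [0] for classes of
   order at most [2], in particular for empty ones. *)
Lemma CN_energy_cliques (C : numClosedFieldType) (G : sgraph) (I : finType)
    (c : G -> I) :
  (forall u v : G, adj u v = (u != v) && (c u == c v)) ->
  CN_energy C G
    = (\sum_a 2 * ((#|[set u | c u == a]| - 1)
                   * (#|[set u | c u == a]| - 2)))%N%:R.
Proof.
move=> adjE.
pose d (i : 'I_#|G|) : 'I_#|I| := enum_rank (c (enum_val i)).
pose s (a : 'I_#|I|) := #|[set i | d i == a]|.
have sE a : #|[set u | c u == a]| = s (enum_rank a).
  rewrite /s -(card_imset _ (@enum_val_inj _ G)); apply: eq_card => u.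
  rewrite inE; apply/eqP/imsetP => [cu|[i]]; last first.
    by rewrite inE => /eqP/enum_rank_inj di ->.
  exists (enum_rank u); last by rewrite enum_rankK.
  by rewrite inE /d enum_rankK cu.
(* Subtraction in [C], not truncated: the value is negative for classes of order 0 or 1. *)
pose w a : C := (s a)%:R - 2.
have AE i j : CN_mx C G i j = if i == j then 0
                              else if d i == d j then w (d i) else 0.
  rewrite mxE; case: eqVneq => // ne_ij.
  rewrite (inj_eq enum_rank_inj).
  set u := enum_val i; set v := enum_val j.
  have ne_uv : u != v by rewrite (inj_eq enum_val_inj).
  have cnE : common_nbrs u v
    = [set x | [&& c x == c u, c u == c v, x != u & x != v]].
    apply/setP=> x; rewrite !inE !adjE ![x == _]eq_sym (eq_sym (c x)).
    have [<-|_] := eqVneq (c u) (c x); rewrite ?andbT ?andbF //=.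
    by rewrite (eq_sym (c v)); case: (c u == c v); rewrite ?andbT ?andbF.
  have [cuv|ne_c] := eqVneq (c u) (c v); last first.
    by apply/eqP; rewrite pnatr_eq0 cnE cards_eq0; apply/eqP/setP=> x;
       rewrite !inE (negbTE ne_c) andbF.
  have := sE (c u); rewrite (cardsD1 u) inE eqxx (cardsD1 v) !inE.
  rewrite eq_sym ne_uv cuv eqxx /= /w /d -/u cuv => <-.
  rewrite -natrB; last by rewrite !addnA leq_addr.
  congr _%:R; rewrite !addnA addKn cnE; apply: eq_card => x.
  by rewrite !inE cuv eqxx /= andbC -andbA [in RHS]andbCA.
have := char_poly_blocks AE; rewrite spectrumP.
set t := spectrum _ => charE.
(* Equal products of monic linear factors have the same roots with multiplicity. *)
have perm_t : perm_eq (t ++ [seq - w a | a <- index_enum 'I_#|I|])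
   ([seq - w (d i) | i <- index_enum 'I_#|G|]
     ++ [seq w a *+ s a - w a | a <- index_enum 'I_#|I|]).
  apply: prod_XsubC_eq; rewrite !big_cat !big_map /=.
  under [X in _ * X = _]eq_bigr do rewrite polyCN opprK.
  under [X in _ = X * _]eq_bigr do rewrite polyCN opprK.
  rewrite charE; congr (_ * _); apply: eq_bigr => a _.
  by rewrite -addrA -[X in _ = _ + X]polyCN opprB -polyCB.
pose f p := (2 * ((p - 1) * (p - 2)))%N.
have normE : \sum_(x <- t ++ _) `|x| = \sum_(x <- _ ++ _) `|x|
  := perm_big _ perm_t.
rewrite !big_cat !big_map /= in normE.
have -> : (\sum_a f #|[set u | c u == a]| = \sum_a f (s a))%N.
  rewrite [RHS](reindex enum_rank) /=; last exact/onW_bij/enum_rank_bij.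
  by apply: eq_bigr => a _; rewrite sE.
(* Restoring the appended roots [- w a] makes the claim split class by class:
   [s * |w| + |s * w - w| = f s + |w|]. *)
apply: (addIr (\sum_a `|- w a|)); rewrite [LHS]normE.
rewrite (partition_big d predT) //= natr_sum -!big_split /=.
apply: eq_bigr => a _.
rewrite (eq_bigr (fun=> `|w a|)) => [|i /eqP->]; last exact: normrN.
rewrite sumr_const normrN /w.
have -> : #|[pred i | d i == a]| = s a by apply: eq_card => i; rewrite inE.
case: (s a) => [|[|p]].
- by rewrite (_ : f 0 = 0)%N // !mulr0n !add0r opprK normrN.
- by rewrite (_ : f 1 = 0)%N // !mulr1n subrr normr0 addr0 mulr0n add0r.
have -> : p.+2%:R - 2 = p%:R :> C by rewrite -natrB // subn2.
rewrite [X in _ + `|X|](_ : _ = (p * p.+1)%:R); last first.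
  by rewrite mulrS addrAC subrr add0r -mulrnA.
rewrite !normr_nat -mulrnA -!natrD /f; congr _%:R; lia.
Qed.

Lemma CN_energy_complete (C : numClosedFieldType) (n : nat) :
  CN_energy C (complete n) = (2 * ((n - 1) * (n - 2)))%N%:R.
Proof.
rewrite (CN_energy_cliques C (c := fun=> tt)) => [|u v]; last by rewrite andbT.
rewrite (big_pred1 tt) => [|[]//].
suff -> : #|[set u : complete n | tt == tt]| = n by [].
by rewrite -[RHS]card_ord; apply: eq_card => x; rewrite !inE.
Qed.

Definition component (r : nat) (l m : 'I_r -> nat)
    (u : union_of_completes l m) : {i : 'I_r & 'I_(l i)} :=
  Tagged (fun i => 'I_(l i)) (tag (tagged u)).

Lemma adj_union_of_completes (r : nat) (l m : 'I_r -> nat)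
    (u v : union_of_completes l m) :
  adj u v = (u != v) && (component u == component v).
Proof.
case: u v => [i [a x]] [j [b y]].
rewrite /component /= /dunion_adj /=.
have [eq_ij|ne_ij] := eqVneq i j; last first.
  by rewrite -!tag_eqE /tag_eq /= (negbTE ne_ij).
case: j / eq_ij b y => b y.
rewrite !tagged_asE !eq_Tagged /= /dunion_adj /=.
have [eq_ab|ne_ab] := eqVneq a b; last by rewrite andbF.
by case: b / eq_ab y => y; rewrite tagged_asE eq_Tagged /= andbT.
Qed.

Lemma sum_card_fibers (T I : finType) (c : T -> I) :
  (\sum_a #|[set u | c u == a]| = #|T|)%N.
Proof.
rewrite -sum1_card (partition_big c predT) //=.
by apply: eq_bigr => a _; rewrite -sum1_card; apply: eq_bigl => u; rewrite inE.
Qed.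

Lemma sum_clique_energy_lt (I : finType) (s : I -> nat) :
  (1 < #|I|)%N -> (forall a, 0 < s a)%N -> (2 < \sum_a s a)%N ->
  (\sum_a 2 * ((s a - 1) * (s a - 2))
     < 2 * ((\sum_a s a - 1) * (\sum_a s a - 2)))%N.
Proof.
move=> I_gt1 s_gt0; set N := (\sum_a s a)%N => N_gt2.
(* A second class [b] exists and is nonempty. *)
have s_lt a : (s a < N)%N.
  have /card_gt0P [b] : (0 < #|[set~ a]|)%N by rewrite cardsC1 -subn1 subn_gt0.
  rewrite !inE => ne_ba; rewrite /N (bigD1 a) //= (bigD1 b) //=.
  by have := s_gt0 b; lia.
have sum_pred : (\sum_a (s a - 1) + #|I| = N)%N.
  rewrite -sum1_card -big_split; apply: eq_bigr => a _ /=.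
  by rewrite subnK.
have : (\sum_a 2 * ((s a - 1) * (s a - 2)) <= 2 * (N - 3) * \sum_a (s a - 1))%N.
  rewrite big_distrr; apply: leq_sum => a _ /=.
  rewrite -mulnA leq_mul2l /= mulnC leq_mul2r.
  by have := s_lt a; lia.
move/leq_ltn_trans; apply.
rewrite -mulnA ltn_mul2l /= mulnC.
(* By [sum_pred] and [1 < #|I|], the sum of [s a - 1] is at most [N - 2]; strictness uses
   [2 < N]. *)
by apply: (@leq_ltn_trans ((N - 2) * (N - 3))); [rewrite leq_mul2r; lia | nia].
Qed.

(** The last two hypotheses exclude the cases of equality: a single clique is itself complete, and
    on at most two vertices both energies are 0. *)
Theorem theorem5p4 (C : numClosedFieldType) (r : nat) (l m : 'I_r -> nat)
    (r_ge1 : (1 <= r)%N)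
    (l_pos : forall i : 'I_r, (0 < l i)%N)
    (m_pos : forall i : 'I_r, (1 <= m i)%N)
    (m_incr : forall i j : 'I_r, (i < j)%N -> (m i < m j)%N)
    (components_gt1 : (1 < \sum_(i < r) l i)%N)
    (order_gt2 : (2 < #|union_of_completes l m|)%N) :
  (CN_energy C (complete #|union_of_completes l m|)
     > CN_energy C (union_of_completes l m))%R.
Proof.
rewrite CN_energy_complete.
rewrite (CN_energy_cliques C (@adj_union_of_completes r l m)).
rewrite ltr_nat -(sum_card_fibers (@component r l m)).
apply: sum_clique_energy_lt; last by rewrite sum_card_fibers.
  rewrite card_tagged sumnE big_map big_enum /=.
  by under eq_bigr do rewrite card_ord.
case=> i a; apply/card_gt0P.
(* Vertex 0 of the chosen copy, available since [m i] is positive. *)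
exists (Tagged (fun i => {j : 'I_(l i) & 'I_(m i)})
          (existT (fun=> 'I_(m i)) a (Ordinal (m_pos i)))).
by rewrite inE.
Qed.
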